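(* For all integers $r,n\ge0$ there is a bijection $\phi^{\mathrm{pix}}:D_n^*(r)\to W_n(r)$, $(w_0,(w_1,i_1),\dots,(w_m,i_m))\mapsto w$, such that $$i_1+\cdots+i_m=\mathrm{wlec}\,w,\qquad i_1+\cdots+i_m+\mathrm{tot}\,w_0+\mathrm{tot}\,w_1+\cdots+\mathrm{tot}\,w_m=\mathrm{tot}\,w,\qquad \lambda w_0=\mathrm{wpix}\,w.$$
   Context: $W_n(r)=\{0,\dots,r\}^n$. For a word $c$, $\lambda c$ is its length and $\mathrm{tot}\,c$ the sum of its letters. $\mathrm{NIW}(r)$: nonincreasing words (any length $\ge0$) with letters in $\{0,\dots,r\}$. $D(r)$: pairs $(w,i)$ with $w\in\mathrm{NIW}(r-1)$, $\lambda w\ge2$, $1\le i\le\lambda w-1$. $D_n^*(r)$: sequences $(w_0,(w_1,i_1),\dots,(w_m,i_m))$, $m\ge 0$, with $w_0\in\mathrm{NIW}(r)$, $(w_j,i_j)\in D(r)$, $\lambda w_0+\cdots+\lambda w_m=n$. An $H$-word is a word $x_1\cdots x_k$ of nonnegative integers with $k\ge2$, $x_1<x_2$, and either $k=2$ or $x_2\ge x_3\ge\cdots\ge x_k$. Every word $w$ factors uniquely as $u\,h_1\cdots h_k$ with $u$ nonincreasing (possibly empty) and each $h_i$ an $H$-word (the $H$-factorization). Then $\mathrm{wpix}\,w=\lambda u$ and $\mathrm{wlec}\,w=\sum_{i=1}^k\mathrm{rinv}\,h_i$, where $\mathrm{rinv}\,h=\mathrm{inv}$ of the reverse of $h$, and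 $\mathrm{inv}$ of a word is the number of pairs of positions $a<b$ with $x_a>x_b$. *)

(* Defs.v *)
From mathcomp Require Import all_boot.

Set Implicit Arguments.
Unset Strict Implicit.
Unset Printing Implicit Defensive.

Notation word := (seq nat).

Definition tot (w : word) : nat := sumn w.

Definition words (n r : nat) (w : word) : bool :=
  (size w == n) && all (fun x => x <= r) w.

(* Indexed by the number k of letters, {0, .., k-1}, so that NIW(r) is
   niw r.+1 and NIW(r-1) is niw r; for r = 0 the latter alphabet is empty and
   [::] is the only such word. *)
Definition niw (k : nat) (w : word) : bool :=
  sorted geq w && all (fun x => x < k) w.

Definition deco (r : nat) (d : word * nat) : bool :=
  [&& niw r d.1, 2 <= size d.1 & 1 <= d.2 <= (size d.1).-1].

(* The sequence (w_0, (w_1, i_1), .., (w_m, i_m)) is encoded as the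
   pair of w_0 and the list of the (w_j, i_j). *)
Definition decos (n r : nat) (d : word * seq (word * nat)) : bool :=
  [&& niw r.+1 d.1, all (deco r) d.2 &
      size d.1 + \sum_(p <- d.2) size p.1 == n].

(* The condition "k = 2 or x_2 >= .. >= x_k" is sortedness of the tail, which
   holds trivially for k = 2. *)
Definition Hword (h : word) : bool :=
  [&& 2 <= size h, nth 0 h 0 < nth 0 h 1 & sorted geq (behead h)].

Definition is_Hfact (w u : word) (hs : seq word) : Prop :=
  [/\ w = u ++ flatten hs, sorted geq u & all Hword hs].

(* The H-factorization (u, [:: h_1; ..; h_k]), computed from right to left;
   HfactP shows that it is the only one in the sense of is_Hfact. *)
Fixpoint Hfact (w : word) : word * seq word :=
  if w is x :: w' then
    let: (u, hs) := Hfact w' in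
    if (u != [::]) && (x < head 0 u) then ([::], (x :: u) :: hs)
    else (x :: u, hs)
  else ([::], [::]).

Lemma Hfact_sorted_cat (u w : word) (hs : seq word) :
  sorted geq u -> Hfact w = ([::], hs) -> Hfact (u ++ w) = (u, hs).
Proof.
move=> su Ew; elim: u su => [|x u IHu] //= su.
rewrite (IHu (path_sorted su)); case: u su {IHu} => [|y u] //=.
by case/andP; rewrite leqNgt => /negbTE ->.
Qed.

Lemma HfactP (w u : word) (hs : seq word) :
  is_Hfact w u hs <-> Hfact w = (u, hs).
Proof.
split=> [[-> su]|].
  move=> Hhs; apply: Hfact_sorted_cat => //.
  elim: hs Hhs => [|h hs IHhs] //= /andP[].
  case: h => [|x [|y h]] // /and3P[_ /= ltxy sh] /IHhs Ehs.
  have /= -> := @Hfact_sorted_cat (y :: h) (flatten hs) hs sh Ehs.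
  by rewrite /= ltxy.
elim: w u hs => [|x w IHw] u hs /=; first by case=> <- <-.
case: (Hfact w) IHw => u' hs' /(_ _ _ erefl)[-> su' Hhs'].
case: u' su' => [|y u'] /= su'; first by case=> <- <-.
case: ltnP => [ltxy|leyx] [<- <-]; split=> //=; last by rewrite leyx.
by rewrite /Hword /= ltxy su'.
Qed.

Definition inv (w : word) : nat :=
  #|[set p : 'I_(size w) * 'I_(size w) |
      (p.1 < p.2) && (nth 0 w p.2 < nth 0 w p.1)]|.

Definition rinv (w : word) : nat := inv (rev w).

Definition wpix (w : word) : nat := size (Hfact w).1.

Definition wlec (w : word) : nat := \sum_(h <- (Hfact w).2) rinv h.

(* Main.v *)
(** An [H]-word is [x :: t] with [t] nonincreasing and [x < head t], and its
    [rinv] is the number [i] of letters of [t] exceeding [x]. These letters form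
    a prefix of [t]: lowering each of them by one and moving [x] just after them
    yields a nonincreasing word, from which [i] allows one to recover the
    [H]-word. The bijection applies the inverse of this operation to each
    [(w_j, i_j)] and concatenates the results after [w_0]. *)

Require Import Defs.
From mathcomp Require Import all_boot.

Set Implicit Arguments.
Unset Strict Implicit.
Unset Printing Implicit Defensive.

(** The moved letter sits at 0-based index [p.2], so exactly [p.2] letters precede it; the default 0
    is not reached when [p.2 < size p.1]. *)
Definition Hword_of (p : word * nat) : word :=
  nth 0 p.1 p.2 :: map succn (take p.2 p.1) ++ drop p.2.+1 p.1.

(** On an H-word the two filters cut the nonincreasing tail into a prefix and the remaining suffix,
    so no cutting index has to be searched for. *)
Definition deco_of (h : word) : word * nat :=
  let x := head 0 h in
  let a := [seq y <- behead h | x < y] in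
  (map predn a ++ x :: [seq y <- behead h | y <= x], size a).

Lemma all_flatten (T : Type) (a : pred T) (ss : seq (seq T)) :
  all a (flatten ss) = all (all a) ss.
Proof. by elim: ss => //= s ss IHss; rewrite all_cat IHss. Qed.

Lemma geq_trans : transitive geq.
Proof. by move=> y x z /= le_yx le_zy; apply: leq_trans le_yx. Qed.

Lemma sorted_geq_pairwise (w : word) : sorted geq w = pairwise geq w.
Proof. exact/sorted_pairwise/geq_trans. Qed.

(** A nondecreasing [s] has no inversions of its own, so every inversion pairs the last letter with
    a larger letter of [s]. Reversed H-words have this shape. *)
Lemma inv_rcons_sorted (s : word) (x : nat) :
  sorted leq s -> Defs.inv (rcons s x) = count (fun y => x < y) s.
Proof.
move=> ss.
(* The right position is the outer index, so that the last letter splits off as the last summand. *)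
have invE w : Defs.inv w = \sum_(j < size w) \sum_(i < size w)
    ((i < j) && (nth 0 w j < nth 0 w i)).
  rewrite exchange_big pair_big /= -big_mkcond sum1dep_card /Defs.inv.
  by apply: eq_card => p; rewrite !inE.
rewrite invE size_rcons big_ord_recr /= big1 ?add0n => [|j _].
  rewrite big_ord_recr /= ltnn addn0 -sum1_count (big_nth 0) big_mkord.
  rewrite [RHS]big_mkcond; apply: eq_bigr => i _ /=.
  by rewrite ltn_ord !nth_rcons ltnn eqxx ltn_ord /=; case: ltnP.
rewrite big1 // => i _; case: ltnP => //= lt_ij.
have lt_j := ltn_ord j; have lt_i := ltn_trans lt_ij lt_j.
rewrite !nth_rcons lt_i lt_j ltnNge.
by rewrite (sorted_leq_nth leq_trans leqnn 0 ss) ?inE // ltnW.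
Qed.

Lemma rinv_cons_sorted (x : nat) (t : word) :
  sorted geq t -> rinv (x :: t) = count (fun y => x < y) t.
Proof.
move=> st; rewrite /rinv rev_cons inv_rcons_sorted ?count_rev //.
by rewrite rev_sorted.
Qed.

(** The bounds on the index become structural: [1 <= i] says that [a] is nonempty, and
    [i <= (size w).-1] that a letter [y] follows the first [i] letters. *)
Lemma decoP (r : nat) (p : word * nat) :
  reflect (exists a y b,
    [/\ p = (a ++ y :: b, size a), a != [::] & niw r (a ++ y :: b)])
    (deco r p).
Proof.
apply: (iffP and3P) => [[]|[a [y [b [-> a_neq0 w_niw]]]]] /=; last first.
  case: a a_neq0 w_niw => //= z a _ w_niw.
  by split; rewrite // size_cat /= addnS // ltnS leq_addr.
case: p => w i /= w_niw w_gt1 /andP[i_gt0 le_i].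
have lt_i : i < size w by case: (size w) w_gt1 le_i.
exists (take i w), (nth 0 w i), (drop i.+1 w).
rewrite -drop_nth // cat_take_drop size_takel ?(ltnW lt_i) //; split=> //.
by rewrite -size_eq0 size_takel ?(ltnW lt_i) // -lt0n.
Qed.

Lemma Hword_of_cat (a b : word) (y : nat) :
  Hword_of (a ++ y :: b, size a) = y :: map succn a ++ b.
Proof.
rewrite /Hword_of /= nth_cat ltnn subnn take_size_cat //.
by rewrite -cat_rcons drop_size_cat ?size_rcons.
Qed.

(** The letter [y] is a pivot: comparisons between [a] and [b] follow from those with [y] by
    transitivity. *)
Lemma sorted_cat_cons (a b : word) (y : nat) :
  sorted geq (a ++ y :: b) =
  [&& all (leq y) a, all (geq y) b & sorted geq a && sorted geq b].
Proof.
rewrite !sorted_geq_pairwise pairwise_cat allrel_consr /=.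
apply/andP/and3P => [[/andP[ya _] /and3P[sa yb sb]]|[ya yb /andP[sa sb]]].
  by rewrite sa sb.
rewrite ya yb sa sb; split=> //=; apply/allrelP => u v /(allP ya) /= yu.
by move=> /(allP yb) /= vy; apply: leq_trans yu.
Qed.

Lemma sorted_map_succn_cat (a b : word) (y : nat) :
  sorted geq (a ++ y :: b) -> sorted geq (map succn a ++ b).
Proof.
rewrite sorted_cat_cons !sorted_geq_pairwise => /and3P[ya yb /andP[sa sb]].
rewrite pairwise_cat pairwise_map sa sb !andbT.
apply/allrelP => _ v /mapP[u /(allP ya) /= yu ->] /(allP yb) /= vy.
exact: leq_trans vy (leqW yu).
Qed.

(** The initial ascent comes from the first letter [z] of the nonempty [a]: [y <= z < z.+1]. *)
Lemma Hword_of_Hword (r : nat) (p : word * nat) :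
  deco r p -> Hword (Hword_of p).
Proof.
case/decoP=> a [y [b [-> a_neq0 /andP[sw _]]]]; rewrite Hword_of_cat.
have st := sorted_map_succn_cat sw; rewrite /Hword /= st andbT.
move: sw; rewrite sorted_cat_cons => /and3P[].
by case: a a_neq0 {st} => //= z a _ /andP[].
Qed.

(** Letters of [p.1] are strictly below [r], which leaves room for raising them by one. *)
Lemma Hword_of_le (r : nat) (p : word * nat) :
  deco r p -> all (fun x => x <= r) (Hword_of p).
Proof.
case/decoP=> a [y [b [-> _ /andP[_]]]]; rewrite Hword_of_cat /= !all_cat /=.
case/and3P=> ar yr br; rewrite all_map (ltnW yr) (sub_all _ br) ?andbT //=.
by move=> z /ltnW.
Qed.

Lemma size_Hword_of (r : nat) (p : word * nat) :
  deco r p -> size (Hword_of p) = size p.1.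
Proof.
case/decoP=> a [y [b [-> _ _]]].
by rewrite Hword_of_cat /= !size_cat size_map addnS.
Qed.

Lemma tot_Hword_of (r : nat) (p : word * nat) :
  deco r p -> tot (Hword_of p) = p.2 + tot p.1.
Proof.
case/decoP=> a [y [b [-> _ _]]]; rewrite Hword_of_cat /tot /= !sumn_cat /=.
have -> : sumn (map succn a) = size a + sumn a.
  by elim: a => //= x a ->; rewrite addSn addnCA.
by rewrite addnCA -!addnA; congr (_ + _); rewrite addnCA.
Qed.

(** Raised letters are at least [y.+1] and letters of [b] at most [y], so comparison with the
    leading [y] separates them again. *)
Lemma Hword_ofK (r : nat) (p : word * nat) :
  deco r p -> deco_of (Hword_of p) = p.
Proof.
case/decoP=> a [y [b [-> _ /andP[]]]]; rewrite sorted_cat_cons.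
case/and3P=> ya yb _ _; rewrite Hword_of_cat /deco_of /= !filter_cat.
have -> : [seq z <- map succn a | y < z] = map succn a.
  by apply/all_filterP; rewrite all_map.
have -> : [seq z <- map succn a | z <= y] = [::].
  rewrite filter_map (eq_in_filter (a2 := pred0)) ?filter_pred0 // => z.
  by move/(allP ya) => /= yz; rewrite ltnNge yz.
have -> : [seq z <- b | z <= y] = b by apply/all_filterP.
have -> : [seq z <- b | y < z] = [::].
  rewrite (eq_in_filter (a2 := pred0)) ?filter_pred0 // => z.
  by move/(allP yb) => /= zy; rewrite ltnNge zy.
by rewrite cats0 size_map (mapK succnK).
Qed.

Lemma rinv_Hword (h : word) : Hword h -> rinv h = (deco_of h).2.
Proof.
by case: h => [|x t] // /and3P[_ _ st]; rewrite rinv_cons_sorted //= size_filter.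
Qed.

(** Once a letter is at most [x], so are all later ones. *)
Lemma sorted_filter_cat (x : nat) (t : word) :
  sorted geq t -> [seq y <- t | x < y] ++ [seq y <- t | y <= x] = t.
Proof.
elim: t => //= y t IHt; rewrite (path_sortedE geq_trans) => /andP[yt st].
case: (ltnP x y) => /= [_|le_yx]; first by rewrite IHt.
have -> : [seq z <- t | x < z] = [::].
  rewrite (eq_in_filter (a2 := pred0)) ?filter_pred0 // => z /(allP yt) /= zy.
  by rewrite ltnNge (leq_trans zy).
congr (_ :: _); apply/all_filterP/allP => z /(allP yt) /= zy.
exact: leq_trans zy le_yx.
Qed.

Lemma deco_ofK (h : word) : Hword h -> Hword_of (deco_of h) = h.
Proof.
case: h => [|x t] // /and3P[_ _ st]; rewrite /deco_of /=.
rewrite -(size_map predn) Hword_of_cat; congr (_ :: _).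
(* Letters exceeding [x] are positive, so [succn] undoes [predn] on them. *)
rewrite -map_comp map_id_in ?sorted_filter_cat // => y.
by rewrite mem_filter => /andP[/ltn_predK].
Qed.

Lemma deco_of_deco (r : nat) (h : word) :
  Hword h -> all (fun x => x <= r) h -> deco r (deco_of h).
Proof.
case: h => [|x [|y t]] // /and3P[_ /= ltxy st] /and3P[_ yr tr].
have {st} sf P : sorted geq (filter P (y :: t)).
  exact: (sorted_filter geq_trans).
apply/decoP; exists (map predn [seq z <- y :: t | x < z]), x.
exists [seq z <- y :: t | z <= x]; split; first by rewrite size_map.
  by rewrite /= ltxy.
(* Lowering sends letters above [x] and at most [r] to letters at least [x] and below [r]: this
   gives both the order around [x] and the smaller alphabet. *)
have lt_pred z : z \in [seq z <- y :: t | x < z] -> x <= z.-1 < r.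
  rewrite mem_filter => /andP[lt_xz z_t].
  rewrite -ltnS (ltn_predK lt_xz) lt_xz.
  by have /allP/(_ z z_t) : all (fun z => z <= r) (y :: t) by rewrite /= yr.
rewrite /niw sorted_cat_cons all_cat; apply/andP; split.
  apply/and3P; split.
  - by apply/allP => _ /mapP[z /lt_pred/andP[lt_xz _] ->].
  - by apply/allP => z; rewrite mem_filter => /andP[].
  rewrite sf andbT; apply: (homo_sorted (e := geq)) (sf _).
  by move=> u v /= le_vu; rewrite -!subn1 leq_sub2r.
apply/andP; split; first by apply/allP => _ /mapP[z /lt_pred/andP[_ ?] ->].
(* The ascent [x < y <= r] puts [x], and with it every letter at most [x], in the smaller
   alphabet. *)
have lt_xr : x < r := leq_trans ltxy yr.
apply/andP; split=> //; apply/allP => z; rewrite mem_filter => /andP[le_zx _].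
exact: leq_ltn_trans lt_xr.
Qed.

Definition word_of_decos (d : word * seq (word * nat)) : word :=
  d.1 ++ flatten (map Hword_of d.2).

Definition decos_of_word (w : word) : word * seq (word * nat) :=
  ((Hfact w).1, map deco_of (Hfact w).2).

(** The concatenation is already an H-factorization, hence the only one; [wpix], [wlec] and the
    inverse map are read off from it. *)
Lemma Hfact_word_of_decos (n r : nat) (d : word * seq (word * nat)) :
  decos n r d -> Hfact (word_of_decos d) = (d.1, map Hword_of d.2).
Proof.
case/and3P=> /andP[s0 _] d2 _; apply/HfactP; split=> //.
by rewrite all_map; apply: sub_all d2 => p; apply: Hword_of_Hword.
Qed.

Lemma word_of_decosK (n r : nat) (d : word * seq (word * nat)) :
  decos n r d -> decos_of_word (word_of_decos d) = d.
Proof.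
move=> dd; rewrite /decos_of_word (Hfact_word_of_decos dd) /=.
case: d dd => w0 ws /and3P[_ /= /allP wsP _]; congr (_, _).
by rewrite -map_comp map_id_in // => p /wsP/Hword_ofK.
Qed.

Lemma word_of_decos_words (n r : nat) (d : word * seq (word * nat)) :
  decos n r d -> words n r (word_of_decos d).
Proof.
case/and3P=> /andP[_ d1] /allP d2 /eqP <-; apply/andP; split.
  rewrite size_cat size_flatten sumnE !big_map; apply/eqP; congr (_ + _).
  by apply: eq_big_seq => p /d2/size_Hword_of.
rewrite all_cat all_flatten all_map d1.
by apply/allP => p /d2/Hword_of_le.
Qed.

Lemma decos_of_wordP (n r : nat) (w : word) :
  words n r w ->
  decos n r (decos_of_word w) /\ word_of_decos (decos_of_word w) = w.
Proof.
case/andP=> /eqP sw wr.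
have [Ew su hsH] : is_Hfact w (Hfact w).1 (Hfact w).2.
  by apply/HfactP; case: (Hfact w).
have EK : map Hword_of (map deco_of (Hfact w).2) = (Hfact w).2.
  by rewrite -map_comp map_id_in // => h /(allP hsH)/deco_ofK.
have Kw : word_of_decos (decos_of_word w) = w.
  by rewrite /word_of_decos /= EK -Ew.
split=> //; move: wr; rewrite {1}Ew all_cat all_flatten => /andP[ur /allP hsr].
have hsD : all (deco r) (map deco_of (Hfact w).2).
  rewrite all_map; apply/allP => h h_in.
  by apply: deco_of_deco; [apply: (allP hsH) | apply: hsr].
apply/and3P; split=> //; first exact/andP.
(* The lengths add up because the blocks reassemble to [w] and [Hword_of] preserves length. *)
rewrite -sw -{3}Kw size_cat size_flatten sumnE !big_map; apply/eqP.
congr (_ + _); apply: eq_big_seq => h h_in; rewrite (@size_Hword_of r) //.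
exact: (allP hsD _ (map_f _ h_in)).
Qed.

Theorem theorem2p3 (r n : nat) :
  exists phi : {d : word * seq (word * nat) | decos n r d} ->
               {w : word | words n r w},
    bijective phi /\
    forall d, let w0 := (sval d).1 in let ws := (sval d).2 in
              let w := sval (phi d) in
      [/\ \sum_(p <- ws) p.2 = wlec w,
          \sum_(p <- ws) p.2 + tot w0 + \sum_(p <- ws) tot p.1 = tot w
        & size w0 = wpix w].
Proof.
exists (fun d => exist (words n r) _ (word_of_decos_words (svalP d))); split.
  exists (fun w => exist (decos n r) _ (decos_of_wordP (svalP w)).1) => [[d dd]|[w ww]].
    by apply: val_inj; apply: word_of_decosK dd.
  by apply: val_inj; apply: (decos_of_wordP ww).2.
case=> [[w0 ws] dd] /=; rewrite /wpix /wlec (Hfact_word_of_decos dd) /=.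
case/and3P: dd => _ /= /allP wsP _; split=> //.
  (* [rinv] of an H-word is the index returned by [deco_of], here the original [p.2]. *)
  rewrite big_map; apply: eq_big_seq => p /wsP pP.
  by rewrite rinv_Hword ?(Hword_ofK pP) ?(Hword_of_Hword pP).
rewrite /tot sumn_cat sumn_flatten [sumn (map _ _)]sumnE !big_map.
(* Each index is grouped with the total of its own word; together they make the total of one
   H-word. *)
rewrite addnAC -big_split addnC.
by congr (_ + _); apply: eq_big_seq => p /wsP/tot_Hword_of.
Qed.
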